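(* Let $(X,\rho)$ be a compact metric space and let $\{\tau_n\}_{n\ge 0}$, $\tau_n:X\to X$, be a sequence of Borel measurable transformations, with $\tau_0=\mathrm{id}_X$, converging uniformly on $X$ to a continuous map $\tau:X\to X$. Let $\eta$ be a Borel probability measure on $X$. For $i\ge 1$ put $\tau_{(0,i)}=\tau_i\circ\tau_{i-1}\circ\dots\circ\tau_1\circ\tau_0$ and $\nu_i=(\tau_{(0,i)})_*\eta$, and for $n\ge 1$ put $\mu_n=\frac1n\sum_{i=1}^n\nu_i$. Let $\mu$ be a $*$-weak limit point of the sequence $\{\mu_n\}_{n\ge1}$. Then $\mu$ is $\tau$-invariant, i.e. $\tau_*\mu=\mu$.
   Context: For a measurable map $T:X\to X$ and a Borel measure $\mu$ on $X$, $T_*\mu$ is the measure $T_*\mu(A)=\mu(T^{-1}A)$ for Borel sets $A$. Uniform convergence means $\sup_{x\in X}\rho(\tau_n(x),\tau(x))\to0$. A $*$-weak limit point of $\{\mu_n\}$ is a Borel probability measure $\mu$ such that, for some subsequence $n_k\to\infty$, $\int g\,d\mu_{n_k}\to\int g\,d\mu$ for every continuous $g:X\to\mathbb R$. *)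

(* Defs.v *)
From HB Require Import structures.
From mathcomp Require Import all_boot all_order all_algebra.
From mathcomp Require Import all_classical all_reals all_analysis.

Set Implicit Arguments.
Unset Strict Implicit.
Unset Printing Implicit Defensive.

Import Order.TTheory GRing.Theory Num.Theory.
Import numFieldNormedType.Exports.

Local Open Scope classical_set_scope.
Local Open Scope ring_scope.

#[short(type="pointedMetricType")]
HB.structure Definition PointedMetric (R : numDomainType) :=
  { X of Metric R X & Pointed X }.

(* A metric space whose measurable sets are exactly the Borel sets. A
   measurableType is pointed; this excludes only the empty space, which carries
   no probability measure. *)
HB.mixin Record isBorelMetric (R : numDomainType) (d : measure_display) X
    & Metric R X & Measurable d X := {
  borel_measurableE : (@measurable d X : set (set X)) = <<s (@open X) >>
}.

#[short(type="borelMetricType")]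
HB.structure Definition BorelMetric (R : numDomainType) (d : measure_display) :=
  { X of Metric R X & Measurable d X & isBorelMetric R d X }.

(* Every nonempty metric space carries a borelMetricType structure. *)
Definition borel (R : numDomainType) (X : pointedMetricType R) : Type := X.

Section borel_instance.
Context (R : numDomainType) (X : pointedMetricType R).

HB.instance Definition _ := PointedMetric.copy (borel X) X.
HB.instance Definition _ :=
  Measurable.copy (borel X) (g_sigma_algebraType (@open X)).
HB.instance Definition _ :=
  isBorelMetric.Build R (sigma_display (@open X)) (borel X) erefl.

End borel_instance.

(* tau_ i \o ... \o tau_ 1 \o tau_ 0 *)
Fixpoint comp_upto (X : Type) (tau_ : nat -> X -> X) (i : nat) : X -> X :=
  if i is j.+1 then tau_ i \o comp_upto tau_ j else tau_ 0%N.

Section measures.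
Context (R : realType) (d : measure_display) (X : borelMetricType R d).

(* The least upper bound is taken in \bar R, so that no convention about
   suprema of unbounded sets enters. *)
Definition uniformly_converges (tau_ : nat -> X -> X) (tau : X -> X) : Prop :=
  ereal_sup [set (mdist (tau_ n x) (tau x))%:E | x in [set: X]]
    @[n --> \oo] --> 0%E.

Definition image_measure (eta : set X -> \bar R) (tau_ : nat -> X -> X)
    (i : nat) : set X -> \bar R :=
  pushforward eta (comp_upto tau_ i).

(* Junk value at n = 0: the zero measure. *)
Definition average_measure (eta : set X -> \bar R) (tau_ : nat -> X -> X)
    (n : nat) : set X -> \bar R :=
  fun A => ((n%:R^-1)%:E * \sum_(1 <= i < n.+1) image_measure eta tau_ i A)%E.

(* Limit points of (m_ n) with n >= 1; m_ 0 is never used. Continuous functions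
   on the spaces considered are bounded, so the integrals are finite. *)
Definition weak_limit_point (m_ : nat -> set X -> \bar R)
    (m : probability X R) : Prop :=
  exists k : nat -> nat,
    [/\ increasing_seq k, (forall j, (0 < k j)%N) &
      forall g : X -> R, continuous g ->
        (\int[m_ (k j)]_x (g x)%:E)%E @[j --> \oo] --> (\int[m]_x (g x)%:E)%E].

(* Equality of measures is equality on measurable sets: a set function also
   has irrelevant values on the other sets. *)
Definition invariant_measure (m : set X -> \bar R) (tau : X -> X) : Prop :=
  forall A : set X, measurable A -> pushforward m tau A = m A.

End measures.

(* Main.v *)
(* For a bounded Lipschitz function g, uniform convergence makes
   |\int g o tau o tau_(0,i) d eta - \int g o tau_(0,i+1) d eta| tend to 0, so
   by Cesaro and telescoping \int g o tau d mu_n - \int g d mu_n tends to 0, and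
   in the limit \int g o tau d mu = \int g d mu. The indicator function of an
   open set is an increasing limit of such g, so mu and its image under tau
   agree on open sets, a pi-system generating the Borel sets. *)

From HB Require Import structures.
Require Import Defs.
From mathcomp Require Import all_boot all_order all_algebra.
From mathcomp Require Import all_classical all_reals all_analysis measurable_realfun.
From mathcomp Require Import lra.

Set Implicit Arguments.
Unset Strict Implicit.
Unset Printing Implicit Defensive.

Import Order.TTheory GRing.Theory Num.Theory.
Import numFieldNormedType.Exports.

Local Open Scope classical_set_scope.
Local Open Scope ring_scope.

(** * Lipschitz approximation of indicator functions of open sets *)

Section lipschitz_approximation.
Context (R : realType) (X : metricType R).
Implicit Types (k : nat) (U : set X) (x y : X).

(** The one-sided inequality suffices, since [x] and [y] can be swapped, and it is the form that an
    infimum yields directly. Values in the unit interval make measurable such [g] integrable. *)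
Definition unit_lipschitz (k : R) (g : X -> R) : Prop :=
  (forall x, 0 <= g x <= 1) /\
  (forall x y, g x <= g y + k * mdist x y).

Lemma unit_lipschitz_dist (k : R) (g : X -> R) x y :
  unit_lipschitz k g -> `|g x - g y| <= k * mdist x y.
Proof.
move=> [_ gk]; rewrite ler_norml lerNl opprB !lerBlDl gk andbT.
by rewrite metric_sym gk.
Qed.

Lemma unit_lipschitz_continuous (k : R) (g : X -> R) :
  0 <= k -> unit_lipschitz k g -> continuous g.
Proof.
move=> k0 gk x; apply/cvgrPdist_lt => e e0.
(* Dividing by [k + 1] covers the case [k = 0]. *)
have ke : 0 < e / (k + 1) by rewrite divr_gt0// ltr_wpDl.
apply: filterS (nbhsx_ballx x _ ke) => y; rewrite ballEmdist/= => xy.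
apply: le_lt_trans (unit_lipschitz_dist _ _ gk) _.
apply: (@le_lt_trans _ _ ((k + 1) * mdist x y)).
  by rewrite ler_wpM2r ?mdist_ge0// lerDl.
by rewrite mulrC -ltr_pdivlMr// ltr_wpDl.
Qed.

(* The largest k-Lipschitz function below the indicator function of U. *)
Definition indic_approx k U x : R :=
  inf (1 |` [set k%:R * mdist x y | y in ~` U]).

Lemma indic_approx_ge c k U x : c <= 1 ->
  (forall y, ~ U y -> c <= k%:R * mdist x y) -> c <= indic_approx k U x.
Proof.
move=> c1 cU; apply: lb_le_inf; first by exists 1; left.
by move=> _ [->//|[y Uy <-]]; exact: cU.
Qed.

Let has_lbound_approx k U x :
  has_lbound (1 |` [set k%:R * mdist x y | y in ~` U]).
Proof. by exists 0 => _ [->//|[y _ <-]]; rewrite mulr_ge0// mdist_ge0. Qed.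

Lemma indic_approx_le1 k U x : indic_approx k U x <= 1.
Proof. by apply: ge_inf => //; left. Qed.

Lemma indic_approx_le k U x y : ~ U y -> indic_approx k U x <= k%:R * mdist x y.
Proof. by move=> Uy; apply: ge_inf => //; right; exists y. Qed.

(** An infimum of functions that are [k]-Lipschitz in [x] is again [k]-Lipschitz; for the distance
    functions this is the triangle inequality. *)
Lemma indic_approx_lipschitz k U : unit_lipschitz k%:R (indic_approx k U).
Proof.
split=> [x|x y].
  rewrite indic_approx_le1 andbT; apply: indic_approx_ge => // y _.
  by rewrite mulr_ge0// mdist_ge0.
rewrite -lerBlDr; apply: indic_approx_ge.
  by rewrite lerBlDr (le_trans (indic_approx_le1 _ _ _))// lerDl mulr_ge0 ?mdist_ge0.
move=> z Uz; rewrite lerBlDr (le_trans (indic_approx_le _ _ Uz))//.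
by rewrite -mulrDr ler_wpM2l// addrC metric_triangle.
Qed.

Lemma indic_approx_nondecreasing U x : nondecreasing_seq (fun k => indic_approx k U x).
Proof.
move=> m n mn; apply: indic_approx_ge => [|y Uy]; first exact: indic_approx_le1.
rewrite (le_trans (indic_approx_le _ _ Uy))// ler_wpM2r ?mdist_ge0//.
by rewrite ler_nat.
Qed.

Lemma indic_approx_out k U x : ~ U x -> indic_approx k U x = 0.
Proof.
move=> Ux; apply/eqP; rewrite eq_le; have [/(_ x)/andP[-> _] _] :=
  indic_approx_lipschitz k U.
by rewrite (le_trans (indic_approx_le _ _ Ux))// mdistxx mulr0.
Qed.

(** A point of the open set [U] has some distance [e] from the complement, so the value is exactly 1
    once [k] is at least [1 / e]; outside [U] all values are 0. *)
Lemma cvg_indic_approx U x : open U -> indic_approx k U x @[k --> \oo] --> (\1_U x : R).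
Proof.
rewrite openE => oU; have [Ux|Ux] := pselect (U x); rewrite indicE.
  rewrite mem_set//=.
  have /nbhs_ballP[e /= e0 xeU] := oU _ Ux.
  apply: cvg_near_cst; near=> k.
  apply/eqP; rewrite eq_le indic_approx_le1/=; apply: indic_approx_ge => // y Uy.
  have exy : e <= mdist x y.
    rewrite leNgt; apply/negP => xye.
    by apply: Uy; apply: xeU; rewrite ballEmdist.
  rewrite (@le_trans _ _ (k%:R * e))// ?ler_wpM2l// -ler_pdivrMr//.
  by near: k; exact: nbhs_infty_ger.
rewrite memNset//=; under eq_fun do rewrite indic_approx_out//.
exact: cvg_cst.
Unshelve. all: by end_near. Qed.

End lipschitz_approximation.

(** * Borel measures are determined by Lipschitz test functions *)

Section borel_metric.
Context (R : realType) (d : measure_display) (X : borelMetricType R d).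

Lemma borel_open_measurable (U : set X) : open U -> measurable U.
Proof. by move=> oU; rewrite borel_measurableE; exact: sub_sigma_algebra. Qed.

Lemma borel_continuous_measurable (g : X -> R) :
  continuous g -> measurable_fun [set: X] g.
Proof.
move=> /continuousP cg; apply: (measurability _ (RGenOpens.measurableE R)).
move=> _ [_ [a [b ->] <-]]; rewrite setTI.
by apply: borel_open_measurable; apply: cg; exact: interval_open.
Qed.

Lemma borel_continuous_measurable_map (d' : measure_display)
    (Y : borelMetricType R d') (f : X -> Y) :
  continuous f -> measurable_fun [set: X] f.
Proof.
move=> /continuousP cf; apply: (measurability open).
  exact: borel_measurableE.
by move=> _ [U oU <-]; rewrite setTI; apply: borel_open_measurable; exact: cf.
Qed.

Lemma cvg_integral_indic_approx (m : {measure set X -> \bar R}) (U : set X) :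
  open U ->
  (\int[m]_x (indic_approx n U x)%:E)%E @[n --> \oo] --> m U.
Proof.
move=> oU.
rewrite -[X in _ --> m X]setIT -integral_indic//; last exact: borel_open_measurable.
have -> : (\int[m]_x (\1_U x)%:E =
    \int[m]_x limn (fun n => (indic_approx n U x)%:E))%E.
  apply: eq_integral => x _; apply/esym/cvg_lim => //.
  by apply: cvg_EFin; [exact: nearW|exact: cvg_indic_approx].
(* Monotone convergence: the approximants are nonnegative and nondecreasing in [n]. *)
apply: (@cvg_monotone_convergence _ _ _ m _ measurableT
  (fun n x => (indic_approx n U x)%:E)) => //.
- move=> n; apply/measurable_EFinP/borel_continuous_measurable.
  exact: unit_lipschitz_continuous (indic_approx_lipschitz _ _).
- by move=> n x _; rewrite lee_fin; have [/(_ x)/andP[]] := indic_approx_lipschitz n U.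
- by move=> x _ a b ab; rewrite lee_fin; exact: indic_approx_nondecreasing.
Qed.

Lemma eq_measure_unit_lipschitz (m1 m2 : {finite_measure set X -> \bar R}) :
  (forall (k : R) (g : X -> R), 0 <= k -> unit_lipschitz k g ->
    (\int[m1]_x (g x)%:E = \int[m2]_x (g x)%:E)%E) ->
  forall A, measurable A -> m1 A = m2 A.
Proof.
(* The whole space is open and of finite measure, so the constant sequence [setT] is an admissible
   exhaustion. *)
move=> m12; apply: (measure_unique open (fun=> setT)) => //.
- exact: borel_measurableE.
- exact: openI.
- by move=> _; exact: openT.
- by rewrite bigcup_const.
- move=> U oU.
  have := cvg_integral_indic_approx (m:=m2) oU.
  under eq_fun do rewrite -(m12 _ _ _ (indic_approx_lipschitz _ U))//.
  by move=> h2; exact: cvg_unique (cvg_integral_indic_approx (m:=m1) oU) h2.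
- by move=> _; rewrite ltey_eq fin_num_measure.
Qed.

End borel_metric.

(** * Cesaro means and subsequences *)

Section averages.
Context (R : realType).
Implicit Types a b : R^nat.

Lemma cvg_mean a (l : R) : a n @[n --> \oo] --> l ->
  n%:R^-1 * \sum_(1 <= i < n.+1) a i @[n --> \oo] --> l.
Proof.
(* [cesaro] averages the indices from 0 to [n] with factor [1 / (n + 1)], so both the sequence and
   its means are shifted by one. *)
rewrite -cvg_shiftS => /cesaro al; rewrite -cvg_shiftS.
apply: cvg_trans al; apply: near_eq_cvg; apply: nearW => n /=.
by rewrite /arithmetic_mean/= seriesEnat/= big_add1.
Qed.

(* The sum of [b i - a i] and that of [b i - a i.+1] differ by the bounded
   telescoping term [a n.+1 - a 1]. *)
Lemma cvg_mean_shift a b : (forall n, 0 <= a n <= 1) ->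
  b n - a n.+1 @[n --> \oo] --> (0 : R) ->
  n%:R^-1 * \sum_(1 <= i < n.+1) b i - n%:R^-1 * \sum_(1 <= i < n.+1) a i
    @[n --> \oo] --> (0 : R).
Proof.
move=> a01 /cvg_mean ba.
have a0 : n%:R^-1 * (a n.+1 - a 1%N) @[n --> \oo] --> (0 : R).
  rewrite -cvg_shiftS; apply: norm_cvg0.
  apply: (@squeeze_cvgr _ _ _ _ (cst 0) harmonic); last 2 first.
  - exact: cvg_cst.
  - exact: cvg_harmonic.
  apply: nearW => n /=; rewrite normr_ge0/= normrM ger0_norm// ler_piMr//.
  have /andP[? ?] := a01 n.+2; have /andP[? ?] := a01 1%N.
  by rewrite ler_norml; apply/andP; split; lra.
under eq_fun => n.
  rewrite -mulrBr -sumrB.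
  under eq_bigr => i _ do rewrite -(subrKA (a i.+1)).
  rewrite big_split/= telescope_sumr// mulrDr; over.
by have := cvgD (F := eventually) ba a0; rewrite addr0; apply.
Qed.

(** A strictly increasing sequence of naturals dominates its index; this lets limits in [n] be taken
    along a subsequence. *)
Lemma cvg_increasing_seq (k : nat -> nat) :
  increasing_seq k -> k j @[j --> \oo] --> \oo.
Proof.
move=> /leW_mono k_incr.
have jk j : (j <= k j)%N.
  elim: j => // j ih; apply: leq_ltn_trans ih _.
  by have := k_incr j j.+1; rewrite ltEnat/= => ->.
apply/cvgnyPge => A; near=> j; apply: leq_trans (jk j).
by near: j; exact: nbhs_infty_ge.
Unshelve. all: by end_near. Qed.

End averages.

(** * Integrals against [eta] and against the averaged measures *)

Section integrals.
Context (R : realType) (d : measure_display) (X : borelMetricType R d).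
Variables (eta : probability X R).

Lemma unit_integrable (f : X -> R) : measurable_fun [set: X] f ->
  (forall x, 0 <= f x <= 1) -> eta.-integrable [set: X] (EFin \o f).
Proof.
move=> mf f01; apply: measurable_bounded_integrable => //.
  by rewrite ltey_eq fin_num_measure.
exists 1; split=> // r r1 x _ /=; have /andP[f0 f1] := f01 x.
by rewrite ger0_norm// (le_trans f1)// ltW.
Qed.

Lemma Rintegral_probability_cst (r : R) : \int[eta]_(x in [set: X]) r = r.
Proof.
have etaT : fine (eta [set: X]) = 1 by rewrite (probability_setT eta).
by rewrite Rintegral_cst//= etaT mulr1.
Qed.

Lemma unit_Rintegral (f : X -> R) : measurable_fun [set: X] f ->
  (forall x, 0 <= f x <= 1) -> 0 <= \int[eta]_x f x <= 1.
Proof.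
move=> mf f01; rewrite Rintegral_ge0/=; last by move=> x _; case/andP: (f01 x).
rewrite -[leRHS]Rintegral_probability_cst; apply: le_Rintegral => //.
- exact: unit_integrable.
- by apply: unit_integrable => // x; rewrite ler01 lexx.
- by move=> x _; case/andP: (f01 x).
Qed.

(** Because [eta] has total mass 1, a pointwise bound passes unchanged to the integrals. *)
Lemma Rintegral_dist (f g : X -> R) (e : R) :
  measurable_fun [set: X] f -> (forall x, 0 <= f x <= 1) ->
  measurable_fun [set: X] g -> (forall x, 0 <= g x <= 1) ->
  (forall x, `|f x - g x| <= e) ->
  `|\int[eta]_x f x - \int[eta]_x g x| <= e.
Proof.
move=> mf f01 mg g01 fge.
have intf := unit_integrable mf f01; have intg := unit_integrable mg g01.
have intfg : eta.-integrable [set: X] (EFin \o (fun x => f x - g x)).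
  by have := integrableB measurableT intf intg.
rewrite -RintegralB//; apply: le_trans (le_normr_Rintegral _ _) _ => //.
rewrite -[leRHS]Rintegral_probability_cst; apply: le_Rintegral => //.
- exact: integrable_norm.
- exact: finite_measure_integrable_cst.
Qed.

Variable tau_ : nat -> X -> X.
Hypothesis tau_measurable : forall n, measurable_fun [set: X] (tau_ n).

Lemma comp_upto_measurable i : measurable_fun [set: X] (comp_upto tau_ i).
Proof. by elim: i => [|i ih] //=; exact: measurableT_comp. Qed.

Lemma integral_average_measure (g : X -> R) (n : nat) :
  measurable_fun [set: X] g -> (forall x, 0 <= g x <= 1) ->
  (\int[average_measure eta tau_ n]_x (g x)%:E =
   (n%:R^-1 * \sum_(1 <= i < n.+1) \int[eta]_x g (comp_upto tau_ i x))%:E)%E.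
Proof.
move=> mg g01.
pose T i : {mfun X >-> X} :=
  HB.pack (comp_upto tau_ i)
    (isMeasurableFun.Build _ _ _ _ _ (comp_upto_measurable i)).
have g0 x : (0 <= (g x)%:E)%E by rewrite lee_fin; case/andP: (g01 x).
have mg' : measurable_fun [set: X] (EFin \o g) by exact/measurable_EFinP.
(* [average_measure] is a bare set function; as a scaled sum of image measures it becomes a measure,
   to which linearity and change of variables apply. [msum] counts from 0, hence [T i.+1]. *)
have -> : average_measure eta tau_ n =
    mscale (n%:R^-1)%:nng (msum (fun i => distribution eta (T i.+1)) n).
  apply/funext => A; rewrite /average_measure /mscale /msum/=.
  by rewrite big_add1/= big_mkord.
rewrite ge0_integral_mscale//= ge0_integral_measure_sum//.
rewrite EFinM -sumEFin big_add1/= big_mkord; congr (_ * _)%E.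
apply: eq_bigr => i _; rewrite ge0_integral_pushforward//.
rewrite preimage_setT fineK//; apply: integrable_fin_num => //.
apply: unit_integrable => //; apply: measurableT_comp => //.
exact: (comp_upto_measurable i.+1).
Qed.

End integrals.

(** * Passage to the limit and invariance *)

Lemma unit_lipschitz_integral_invariant (R : realType) (d : measure_display)
    (X : borelMetricType R d) (tau_ : nat -> X -> X) (tau : X -> X)
    (eta mu : probability X R) (k : R) (g : X -> R) :
  (forall n, measurable_fun [set: X] (tau_ n)) ->
  uniformly_converges tau_ tau -> continuous tau ->
  weak_limit_point (average_measure eta tau_) mu ->
  0 <= k -> unit_lipschitz k g ->
  (\int[mu]_x (g (tau x))%:E = \int[mu]_x (g x)%:E)%E.
Proof.
move=> mtau_ tau_cvg ctau [j [j_incr _ mu_lim]] k0 gk.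
have cg := unit_lipschitz_continuous k0 gk.
have g01 := gk.1.
have cgt : continuous (g \o tau).
  by move=> x; apply: continuous_comp; [exact: ctau|exact: cg].
have mg := borel_continuous_measurable cg.
have mgt := borel_continuous_measurable cgt.
have mT := comp_upto_measurable mtau_.
(* These are the integrals of [g] and [g \o tau] against the [i]-th image measure. [b n] and
   [a n.+1] differ only in applying [tau] or [tau_ n.+1] to the same point [comp_upto tau_ n x]. *)
pose a i := \int[eta]_x g (comp_upto tau_ i x).
pose b i := \int[eta]_x g (tau (comp_upto tau_ i x)).
have mgT i : measurable_fun [set: X] (g \o comp_upto tau_ i).
  exact: measurableT_comp.
have mgtT i : measurable_fun [set: X] (g \o tau \o comp_upto tau_ i).
  exact: measurableT_comp.
have a01 i : 0 <= a i <= 1 by apply: (unit_Rintegral eta (mgT i)) => x; exact: g01.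
have ba : b n - a n.+1 @[n --> \oo] --> (0 : R).
  apply/cvgrPdist_le => e e0.
  have ke : 0 < e / (k + 1) by rewrite divr_gt0// ltr_wpDl.
  have [N _ supN] := tau_cvg _ (open_ereal_lt' (ke : (0 < (e / (k + 1))%:E)%E)).
  (* The bound is taken at [n.+1], the index of the outermost map in [a n.+1]. *)
  exists N => // n /= Nn; have /= supn := supN n.+1 (leqW Nn).
  rewrite sub0r normrN.
  apply: (Rintegral_dist eta (mgtT n) _ (mgT n.+1)) => [x|x|x /=]; try exact: g01.
  apply: le_trans (unit_lipschitz_dist _ _ gk) _.
  rewrite metric_sym /=; set y := comp_upto tau_ n x.
  have : mdist (tau_ n.+1 y) (tau y) <= e / (k + 1).
    rewrite -lee_fin (le_trans _ (ltW supn))//.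
    by apply: ereal_sup_ubound; exists y.
  rewrite ler_pdivlMr ?ltr_wpDl// => /(le_trans _); apply.
  by rewrite mulrC ler_wpM2l ?mdist_ge0// lerDl.
have fin (f : X -> R) : continuous f -> (forall x, 0 <= f x <= 1) ->
    (\int[mu]_x (f x)%:E)%E \is a fin_num.
  move=> cf f01; apply: integrable_fin_num => //; apply: unit_integrable => //.
  exact: borel_continuous_measurable.
(* Stated for continuous [f] because it is also applied to [g \o tau], which need not be
   Lipschitz. *)
have mean_cvg (f : X -> R) : continuous f -> (forall x, 0 <= f x <= 1) ->
    (j i)%:R^-1 * \sum_(1 <= l < (j i).+1) \int[eta]_x f (comp_upto tau_ l x)
      @[i --> \oo] --> (\int[mu]_x f x : R).
  move=> cf f01; have := mu_lim _ cf.
  under eq_fun do rewrite (integral_average_measure _ mtau_ _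
    (borel_continuous_measurable cf) f01).
  by rewrite -(fineK (fin _ cf f01)) => /fine_cvg.
rewrite -(fineK (fin _ cg g01)) -(fineK (fin (g \o tau) cgt (fun=> g01 _))).
congr EFin; apply/eqP; rewrite -subr_eq0; apply/eqP.
(* Along [j] the difference of the means tends both to 0 and to the difference of the integrals
   against [mu]; limits are unique. *)
have diff0 := cvg_comp _ _ (cvg_increasing_seq j_incr) (cvg_mean_shift a01 ba).
have diff := cvgB (F := eventually) (mean_cvg (g \o tau) cgt (fun=> g01 _))
  (mean_cvg g cg g01).
rewrite -(cvg_lim (@Rhausdorff R) diff0); apply/esym/cvg_lim => //; exact: diff.
Qed.

Theorem theorem1 (R : realType) (d : measure_display) (X : borelMetricType R d)
    (tau_ : nat -> X -> X) (tau : X -> X)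
    (eta mu : probability X R)
    (X_compact : compact [set: X])
    (tau_measurable : forall n, measurable_fun [set: X] (tau_ n))
    (tau_0 : tau_ 0%N = idfun)
    (tau_cvg : uniformly_converges tau_ tau)
    (tau_continuous : continuous tau)
    (mu_limit : weak_limit_point (average_measure eta tau_) mu) :
  invariant_measure mu tau.
Proof.
pose mtau := borel_continuous_measurable_map tau_continuous.
(* Packing [tau] as a measurable map makes its pushforward a finite measure, comparable with [mu]
   through Lipschitz test functions. *)
pose tauM : {mfun X >-> X} := HB.pack tau (isMeasurableFun.Build _ _ _ _ _ mtau).
apply: (eq_measure_unit_lipschitz (m1 := distribution mu tauM)) => k g k0 gk.
rewrite -(unit_lipschitz_integral_invariant tau_measurable tau_cvg
  tau_continuous mu_limit k0 gk).
rewrite ge0_integral_pushforward ?preimage_setT//.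
- apply/measurable_EFinP/borel_continuous_measurable.
  exact: unit_lipschitz_continuous k0 gk.
- by move=> x _; rewrite lee_fin; case/andP: (gk.1 x).
Qed.
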